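(* Let $D$ be a division algebra that is finite dimensional over its center $F$, let $G=D^{\#}$, and let $N$ be a normal subgroup of $G$ with $F^{\#}\le N$ such that $G^*=G/N$ is a nonabelian finite simple group. Let $\Delta$ be the commuting graph of $G^*$ and assume that one of the following holds: (I) $\mathrm{diam}(\Delta)>4$, and $A^*,B^*\subseteq G^*\setminus\{1^*\}$ are conjugacy classes of $G^*$ such that $G$ satisfies the $U$-Hypothesis with respect to $\mathbb{N}_{B^*}$, and for all $b\in\mathbb{P}_{B^*}$ there exists $a\in\mathbb{P}_{A^*}$ with $d(a^*,b^* )>4$ and $N(b)\supseteq N(a)$; in this case put $X^*=B^*$; (II) $\Delta$ is balanced, and $C^*\subseteq G^*\setminus\{1^*\}$ is a conjugacy class of $G^*$ such that $G$ satisfies the $U$-Hypothesis with respect to $\mathbb{N}_{C^*}$, and either $\mathbb{O}_{x^*}=\emptyset$ for some $x^*\in G^*\setminus\{1^*\}$, or for all $m\in\mathbb{M}_{C^*}$ there exists $z^*\in C^*$ such that $m\in N(z_1)$ for all $z_1\in\mathbb{O}_{z^*}$; in this case put $X^*=C^*$. Put $U=U_{X^*}$, $\mathbb{M}=\mathbb{M}_{X^*}$, $\mathbb{O}=\{a\in D^{\#}:\nu(a)=1\}$, where $\nu:D^{\#}\to F^{\#}$ is the reduced norm, and $$\hat K=\{a\in \mathbb{O}U\setminus N : N(a)\supseteq \mathbb{M}\}.$$ Then $\hat K=\mathbb{O}U\setminus N$.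
   Context: Notation: $D^{\#}=D\setminus\{0\}$, $F^{\#}=F\setminus\{0\}$; for $a\in G$, $a^*=Na\in G^*$; $N(a)=\{n\in N: a+n\in N\}$; $\mathbb{O}U=\{xu:x\in\mathbb{O},u\in U\}$. The commuting graph $\Delta$ of $G^*$ has vertex set $G^*\setminus\{1^*\}$, distinct vertices being adjacent iff they commute; $d$ is its distance function (with value $\infty$ between different components) and $\mathrm{diam}(\Delta)$ is the supremum of the distances. $\Delta$ is balanced if there exist vertices $x^*,y^*$ such that $d(x^*,y^* )$, $d(x^*,x^*y^* )$, $d(y^*,x^*y^* )$, $d(x^*,(x^{-1}y)^* )$, $d(y^*,(x^{-1}y)^* )$ are all greater than $3$. For $x^*\in G^*\setminus\{1^*\}$: $\mathbb{P}_{x^*}=\{a\in Nx:1\in N(a)\}$; $\mathbb{N}_{x^*}=\{n\in N: n\in N(a)\text{ for all }a\in\mathbb{P}_{x^*}\}$; $\mathbb{O}_{x^*}=\{x_1\in Nx:-1\notin N(x_1)\cup N(x_1^{-1})\}$. For a conjugacy class $C^*\subseteq G^*\setminus\{1^*\}$: $\mathbb{P}_{C^*}=\bigcup_{y^*\in C^*}\mathbb{P}_{y^*}$; $\mathbb{N}_{C^*}=\bigcap_{y^*\in C^*}\mathbb{N}_{y^*}$; $U_{C^*}=\{n\in N:n,n^{-1}\in\mathbb{N}_{C^*}\}$ (here it is a normal subgroup of $G$); $\mathbb{M}_{C^*}=\mathbb{N}_{C^*}\setminus U_{C^*}$. (The symbols $\mathbb{N}$ denote these subsets of $N$, not the natural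 numbers.) $U$-Hypothesis: given a subset $\mathbb{N}$ of $N$, $G$ satisfies the $U$-Hypothesis with respect to $\mathbb{N}$ if $\emptyset\neq\mathbb{N}\subsetneq N$, $\mathbb{N}$ is invariant under conjugation by $G$, and, with $\bar{\mathbb{N}}=N\setminus\mathbb{N}$: (U1) $1,-1\in\mathbb{N}$; (U2) $\mathbb{N}^2=\mathbb{N}$, where $\mathbb{N}^2=\{ab:a,b\in\mathbb{N}\}$; (U3) for all $\bar n\in\bar{\mathbb{N}}$, $\bar n+1\in\mathbb{N}$ and $\bar n-1\in N$. *)

(* Defs.v *)
From HB Require Import structures.
From mathcomp Require Import all_boot all_order all_fingroup all_algebra.
From mathcomp Require Import all_solvable all_field.
From mathcomp Require Import boolp classical_sets constructive_ereal.

Set Implicit Arguments.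
Unset Strict Implicit.
Unset Printing Implicit Defensive.

Import Order.TTheory GRing.Theory Num.Theory.

Local Open Scope classical_set_scope.
Local Open Scope ring_scope.

Section CommutingGraph.
Variable gT : finGroupType.
Implicit Types x y : gT.

Definition cadj : rel gT :=
  fun x y => [&& x != 1%g, y != 1%g, x != y & (x * y == y * x)%g].

Definition cwalk (k : nat) x y : bool :=
  [exists p : k.-tuple gT, path cadj x p && (last x p == y)].

(* A shortest walk has no repeated vertex, so its length is below #|gT|; the
   minimum over the empty range is +oo. *)
Definition cdist x y : \bar int :=
  \big[mine/+oo%E]_(k < #|gT| | cwalk k x y) (k%:Z)%:E.

Definition cdiam : \bar int :=
  \big[maxe/0%E]_(x : gT | x != 1%g) \big[maxe/0%E]_(y : gT | y != 1%g)
     cdist x y.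

(* The first inequality forces x * y != 1 and x^-1 * y != 1, so all five
   distances are between vertices. *)
Definition cbalanced : Prop :=
  exists x y : gT, [/\ x != 1%g, y != 1%g & [/\
    (3%:Z%:E < cdist x y)%E,
    (3%:Z%:E < cdist x (x * y)%g)%E,
    (3%:Z%:E < cdist y (x * y)%g)%E,
    (3%:Z%:E < cdist x (x^-1 * y)%g)%E &
    (3%:Z%:E < cdist y (x^-1 * y)%g)%E]].

Definition nontrivial_class (C : {set gT}) : Prop :=
  C \in classes [set: gT]%SET /\ 1%g \notin C.

End CommutingGraph.

(* falgType F is the type of finite-dimensional F-algebras, and 1%VS is the
   line F.1 *)
Definition central_division_algebra (F : fieldType) (D : falgType F) : Prop :=
  'Z({:D})%VS = 1%VS /\ (forall x : D, x != 0 -> x \is a GRing.unit).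

(* phi is semilinear along iota, so it extends to an L-algebra morphism from
   the scalar extension of D to L into 'M[L]_n; the last condition says that
   this extension is an isomorphism. *)
Definition splitting (F : fieldType) (D : falgType F) (L : fieldType)
    (iota : {rmorphism F -> L}) (n : nat) (phi : {rmorphism D -> 'M[L]_n}) :
    Prop :=
  (forall (c : F) (x : D), phi (c *: x) = iota c *: phi x) /\
  basis_of {:'M[L]_n} [seq phi e | e <- vbasis {:D}].

(* The determinant over a splitting field; for D central simple it lies in F
   and does not depend on the splitting chosen. *)
Definition reduced_norm (F : fieldType) (D : falgType F) (a : D) : F :=
  xget 0 [set c : F |
    exists (L : fieldType) (iota : {rmorphism F -> L}) (n : nat)
           (phi : {rmorphism D -> 'M[L]_n}),
      splitting iota phi /\ iota c = \det (phi a)].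

Section Subgroups.
Variables (F : fieldType) (D : falgType F).

(* Subgroups of D^# = D \ {0} are represented as subsets of D. *)
Definition nonzero : set D := [set x | x != 0].

Definition normal_subgroup (N : set D) : Prop :=
  [/\ N `<=` nonzero,
      N 1,
      forall x y, N x -> N y -> N (x * y),
      forall x, N x -> N x^-1 &
      forall g x, g != 0 -> N x -> N (g^-1 * x * g)].

(* pi, restricted to D^#, presents gT as the quotient D^# / N: it is a
   surjective morphism with kernel N. The value pi 0 is irrelevant. *)
Definition quotient_map (gT : finGroupType) (pi : D -> gT) (N : set D) :
    Prop :=
  [/\ forall x y, x != 0 -> y != 0 -> pi (x * y) = (pi x * pi y)%g,
      forall g : gT, exists2 x, x != 0 & pi x = g &
      forall x, x != 0 -> (pi x = 1%g <-> N x)].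

(* Nadd N a is the set written N(a); likewise PP, NN, OO, UU, MM below are the
   blackboard-bold P, N, O, then U and blackboard-bold M, indexed by an element
   or by a class of the quotient. *)
Definition Nadd (N : set D) (a : D) : set D := [set n | N n /\ N (a + n)].

Section Quotient.
Variables (N : set D) (gT : finGroupType) (pi : D -> gT).

(* The coset N x, for any x with image xs. *)
Definition cosetN (xs : gT) : set D := [set a | a != 0 /\ pi a = xs].

Definition PP_elt (xs : gT) : set D := [set a | cosetN xs a /\ Nadd N a 1].

Definition NN_elt (xs : gT) : set D :=
  [set n | N n /\ forall a, PP_elt xs a -> Nadd N a n].

Definition OO_elt (xs : gT) : set D :=
  [set x1 | cosetN xs x1 /\ ~ (Nadd N x1 `|` Nadd N x1^-1) (-1)].

Definition PP (C : {set gT}) : set D := \bigcup_(y in [set` C]) PP_elt y.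

Definition NN (C : {set gT}) : set D := \bigcap_(y in [set` C]) NN_elt y.

Definition UU (C : {set gT}) : set D :=
  [set n | [/\ N n, NN C n & NN C n^-1]].

Definition MM (C : {set gT}) : set D := NN C `\` UU C.

End Quotient.

Definition U_hypothesis (N S : set D) : Prop :=
  [/\ S !=set0, S `<` N &
      forall g n, g != 0 -> S n -> S (g^-1 * n * g)] /\
  [/\ S 1 /\ S (-1),
      [set a * b | a in S & b in S] = S &
      forall n, (N `\` S) n -> S (n + 1) /\ N (n - 1)].

Section Cases.
Variables (N : set D) (gT : finGroupType) (pi : D -> gT).

Definition case_I (A B : {set gT}) : Prop :=
  [/\ (4%:Z%:E < cdiam gT)%E,
      nontrivial_class A,
      nontrivial_class B,
      U_hypothesis N (NN N pi B) &
      forall b, PP N pi B b -> exists a, [/\ PP N pi A a,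
        (4%:Z%:E < cdist (pi a) (pi b))%E & Nadd N a `<=` Nadd N b]].

Definition case_II (C : {set gT}) : Prop :=
  [/\ cbalanced gT,
      nontrivial_class C,
      U_hypothesis N (NN N pi C) &
      (exists2 xs : gT, xs != 1%g & OO_elt N pi xs = set0) \/
      (forall m, MM N pi C m -> exists2 zs, zs \in C &
         forall z1, OO_elt N pi zs z1 -> Nadd N z1 m)].

Definition reduced_norm1 : set D := [set a | a != 0 /\ reduced_norm a = 1].

Definition OU (X : {set gT}) : set D :=
  [set x * u | x in reduced_norm1 & u in UU N pi X].

Definition Khat (X : {set gT}) : set D :=
  [set a | (OU X `\` N) a /\ MM N pi X `<=` Nadd N a].

End Cases.

End Subgroups.

(* Main.v *)
Require Import Defs.
From mathcomp Require Import all_boot all_order all_fingroup all_algebra.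
From mathcomp Require Import all_solvable all_field.
From mathcomp Require Import boolp classical_sets constructive_ereal.

Set Implicit Arguments.
Unset Strict Implicit.
Unset Printing Implicit Defensive.

Import GRing.Theory.

Local Open Scope classical_set_scope.
Local Open Scope ring_scope.

(** Both cases provide the U-hypothesis for the set S = NN N pi X.  Write U for
    the elements n of N with n and n^-1 in S, and call n in N small if n is not
    in S, integral if n^-1 is in S.  The model to keep in mind is a valuation:
    integral elements are those of value at least 0, U are the units, small
    elements have positive value, and MM consists of the inverses of small
    elements.  The theorem then says that 1 + x lies in N
    whenever x has positive value, even if x is not in N.

    - The ideal spanned by the small elements.  For n small, 1 + n is in U.  Since U times small
      is small, a product expansion
        1 + n_1 + n_2 + ... = (1 + n_1) (1 + (1 + n_1)^-1 n_2 + ...)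
      shows that 1 + W is contained in U, where W is the additive span of the
      small elements (unit_add1_addspan).  So W is an ideal of the ring A
      spanned by the integral elements, and it lies in the Jacobson radical
      of A.

    - A normal subgroup meeting N inside U.  Let H be the set of nonzero
      elements whose regular determinant, the determinant over F of right
      multiplication on D, is 1; it contains the elements of reduced norm 1
      because the regular determinant is a power of the reduced norm
      (splitting_regdet).  By the factorization theorem of Wedderburn the
      minimal polynomial of x splits over D into factors X - c with c conjugate
      to x, so the regular determinant of x is up to sign a product of
      conjugates of x (regdet_closed).  For x small this product is small, hence
      not 1; consequently H and N meet inside U, and H is covered by
      finitely many cosets of U, indexed by the finite group gT.

    - Nakayama.  Let J be the additive span of the products n h with n small and
      h in H.  If the r_t are coset representatives of H modulo U, then J is the
      sum of the W r_t.  If 1 were in J, every r_t would be in the sum of the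
      W r_t, and Nakayama would give r_t = 0; so 1 is not in J (one_notin_J) and
      the image of 1 + J in gT is a normal subgroup.  As gT is simple there are
      two possibilities.  If the image is trivial, 1 + J is contained in N.  If
      the image is everything, each h in H is (1 + x) n with x in J and n
      integral, so H is contained in A + J; Nakayama for the A-module spanned by
      the r_t modulo A gives that H is contained in A, whence J is contained in
      W A = W, and 1 + J is contained in U.  Either way 1 + J lies in N
      (one_plus_J_sub_N).

    Finally, for a = x u with x of reduced norm 1, u in U, and m in MM, the
    element m^-1 is small and a + m = m (1 + m^-1 x u) with m^-1 x u in J. *)

(** * Wedderburn factorization of minimal polynomials *)

Section DivisionAlgebra.
Variables (F : fieldType) (D : falgType F).
Hypothesis divD : forall x : D, x != 0 -> x \is a GRing.unit.
Implicit Types (x y g : D) (p q : {poly D}).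

Lemma mulD_neq0 x y : x != 0 -> y != 0 -> x * y != 0.
Proof.
move=> /divD ux; apply: contra => /eqP xy0.
by rewrite -[y]mul1r -(mulVr ux) -mulrA xy0 mulr0.
Qed.

Lemma mulD_eq0 x y : x * y = 0 -> x = 0 \/ y = 0.
Proof.
move=> xy0; case: (eqVneq x 0) => [->|nx]; first by left.
case: (eqVneq y 0) => [->|ny]; first by right.
by move: (mulD_neq0 nx ny); rewrite xy0 eqxx.
Qed.

Lemma invD_neq0 x : x != 0 -> x^-1 != 0.
Proof. by move=> /divD; rewrite -unitrV; apply: contraTneq => ->; rewrite unitr0. Qed.

(** Over a noncommutative ring evaluation is not multiplicative: moving the
    value q.[y] past the powers of y conjugates y. *)
Lemma horner_mul_conj p q y : q.[y] != 0 ->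
  (p * q).[y] = p.[q.[y] * y / q.[y]] * q.[y].
Proof.
move=> nq; set c := q.[y]; have uc := divD nq.
elim/poly_ind: p => [|p k IHp]; first by rewrite mul0r !horner0 mul0r.
rewrite mulrDl -mulrA -commr_polyX mulrA !hornerD hornerMX IHp -/c.
rewrite mul_polyC hornerZ hornerMX hornerC -/c mulrDl.
by rewrite -!mulrA mulVr // mulr1.
Qed.

Definition conjugate_of x : set D := [set c | exists2 g, g != 0 & c = g^-1 * x * g].

Lemma conjugate_of_conj x c y : c != 0 -> conjugate_of x y ->
  conjugate_of x (c * y / c).
Proof.
move=> nc [a na ->]; exists (a / c); first by rewrite mulD_neq0 ?invD_neq0.
by rewrite invrM ?unitrV ?divD // invrK !mulrA.
Qed.

Definition vanishes_on_conj x p := forall c, conjugate_of x c -> p.[c] = 0.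

Lemma horner_map_conj g p y : g != 0 ->
  (map_poly (fun a => g^-1 * a * g) p).[g^-1 * y * g] = g^-1 * p.[y] * g.
Proof.
move=> /divD ug; rewrite (@horner_coef_wide _ (size p)); last exact: size_poly.
rewrite horner_coef mulr_sumr mulr_suml; apply: eq_bigr => i _.
rewrite coef_map_id0; last by rewrite mulr0 mul0r.
have -> : (g^-1 * y * g) ^+ i = g^-1 * y ^+ i * g.
  elim: (nat_of_ord i) => [|j IH]; first by rewrite !expr0 mulr1 mulVr.
  by rewrite !exprSr IH -!mulrA (mulrA g) divrr // mul1r !mulrA.
by rewrite -!mulrA (mulrA g) divrr // mul1r !mulrA.
Qed.

Hypothesis centerD : ('Z({:D}) = 1)%VS.

Lemma central_scalar x : (forall g, g != 0 -> g^-1 * x * g = x) ->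
  exists k : F, x = k%:A.
Proof.
move=> xC; apply/vlineP; rewrite -centerD memv_cap memvf /=.
apply/centvP => g _; case: (eqVneq g 0) => [->|ng]; first by rewrite mulr0 mul0r.
by rewrite -{2}(xC g ng) !mulrA divrr ?divD // mul1r.
Qed.

(** A polynomial of least size vanishing on a conjugacy class can be taken
    monic; it is then invariant under conjugation of its coefficients, since
    otherwise the difference with a conjugate would be smaller.  So its
    coefficients are in F, and it vanishes at x itself. *)
Lemma min_size_vanishing (f : {poly F}) x
    (fmin : forall q : {poly F}, q != 0 -> horner_alg x q = 0 ->
            (size f <= size q)%N) p :
  p != 0 -> vanishes_on_conj x p -> (size f <= size p)%N.
Proof.
have [n] := ubnP (size p); elim: n p => // n IHn p le_pn np vp.
have ul : lead_coef p \is a GRing.unit by apply: divD; rewrite lead_coef_eq0.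
pose q : {poly D} := (lead_coef p)^-1 *: p.
have szq : size q = size p by rewrite lreg_size //; apply/mulrI; rewrite unitrV.
have lq : lead_coef q = 1.
  by rewrite /lead_coef szq coefZ -/(lead_coef p) mulVr.
have vq : vanishes_on_conj x q by move=> c /vp pc; rewrite hornerZ pc mulr0.
pose qg g := map_poly (fun a => g^-1 * a * g) q.
have c0 g : g^-1 * 0 * g = 0 :> D by rewrite mulr0 mul0r.
case: (pselect (forall g, g != 0 -> qg g = q)) => [qC | /existsNP[g /not_implyP[ng /eqP qgq]]].
  have coefC i : exists k : F, q`_i = k%:A.
    apply: central_scalar => g ng.
    by rewrite -{2}(qC g ng) coef_map_id0.
  pose k i := projT1 (cid (coefC i)); have kP i : q`_i = (k i)%:A by rewrite /k; case: cid.
  pose q' : {poly F} := \poly_(i < size q) k i.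
  have qq' : map_poly (in_alg D) q' = q.
    apply/polyP => i; rewrite coef_map coef_poly; case: ltnP => [_|le_i].
      by rewrite kP.
    by rewrite raddf0 nth_default.
  have szq' : size q' = size q by rewrite -qq' size_map_poly.
  rewrite -szq -szq'; apply: fmin.
    by rewrite -size_poly_gt0 szq' szq size_poly_gt0.
  rewrite /horner_alg /horner_morph qq'; apply: vq; exists 1; first exact: oner_neq0.
  by rewrite invr1 mul1r mulr1.
have szqg : (size (qg g) <= size p)%N by rewrite -szq size_poly.
(* The leading term 1 is fixed by conjugation, hence cancels. *)
have lt_sz : (size (q - qg g)%R < size p)%N.
  rewrite -(prednK (n := size p)) ?size_poly_gt0 // ltnS; apply/leq_sizeP => j.
  rewrite leq_eqVlt => /orP[/eqP <-|lt_j]; rewrite coefB coef_map_id0 //.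
    by rewrite -szq -/(lead_coef q) lq mulr1 mulVr ?subrr // divD.
  rewrite [q`_j]nth_default ?c0 ?subrr //.
  by rewrite szq -(prednK (n := size p)) ?size_poly_gt0.
apply: leq_trans (ltnW lt_sz); apply: IHn.
- exact: leq_trans lt_sz _.
- by rewrite subr_eq0 eq_sym.
- move=> c cc; rewrite hornerD hornerN (vq c cc) sub0r.
  have -> : c = g^-1 * (g * c / g) * g.
    by rewrite !mulrA mulVr ?divD // mul1r -mulrA mulVr ?divD // mulr1.
  rewrite horner_map_conj // vq ?c0 ?oppr0 //.
  exact: conjugate_of_conj.
Qed.

(** As long as a product h of factors X - c has smaller size than f, it cannot
    vanish on the whole class of x; at a conjugate y where it does not vanish,
    the remaining left cofactor g has the conjugate of y by h.[y] as a root, so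
    one more linear factor can be moved from g to h. *)
Lemma Wedderburn_factorization (f : {poly F}) x :
    f \is monic -> horner_alg x f = 0 ->
    (forall q : {poly F}, q != 0 -> horner_alg x q = 0 -> (size f <= size q)%N) ->
  exists2 s : seq D, {in s, forall c, conjugate_of x c} &
    map_poly (in_alg D) f = \prod_(c <- s) ('X - c%:P).
Proof.
move=> fmon fx0 fmin; set fD := map_poly _ f.
have szf : size fD = size f by rewrite size_map_poly.
have lf : lead_coef fD = 1 by rewrite lead_coef_map (eqP fmon) rmorph1.
have vf : vanishes_on_conj x fD.
  move=> _ [g ng ->].
  have -> : fD = map_poly (fun a => g^-1 * a * g) fD.
    apply/polyP => i; rewrite [RHS]coef_map_id0 ?mulr0 ?mul0r //.
    by rewrite /fD coef_map /= -scalerAr mulr1 -scalerAl mulVr // divD.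
  by rewrite horner_map_conj // [fD.[x]]fx0 mulr0 mul0r.
(* Right-hand linear factors at conjugates are split off while a cofactor g remains. *)
suff ind n : forall (g : {poly D}) (s : seq D),
    (size g <= n)%N -> {in s, forall c, conjugate_of x c} ->
    fD = g * \prod_(c <- s) ('X - c%:P) ->
    exists2 s : seq D, {in s, forall c, conjugate_of x c} &
      fD = \prod_(c <- s) ('X - c%:P).
  by apply: (ind (size fD) fD [::]) => //; rewrite big_nil mulr1.
elim: n => [|n IHn] g s szg sC fgs.
  move: lf; move: szg; rewrite size_poly_leq0 fgs => /eqP ->.
  by rewrite mul0r lead_coef0 => /esym/eqP; rewrite oner_eq0.
set h := \prod_(c <- s) _ in fgs; have hmon : h \is monic by apply: monic_prod_XsubC.
have lg : lead_coef g = 1 by rewrite -lf fgs lead_coef_Mmonic.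
case: (pselect (vanishes_on_conj x h)) => [vh|/existsNP[y /not_implyP[yC /eqP hy]]].
  have szh : (size f <= size h)%N by apply: min_size_vanishing vh => //; apply: monic_neq0.
  exists s => //; rewrite -/h fgs.
  have ng : g != 0 by rewrite -lead_coef_eq0 lg oner_neq0.
  have : (size g <= 1)%N.
    move: szh; rewrite -szf fgs size_Mmonic // -(prednK (n := size g)) ?size_poly_gt0 //.
    by rewrite addSn /= -{2}[size h]add0n leq_add2r leqn0 => /eqP ->.
  move=> /size1_polyC g0; move: lg; rewrite g0 lead_coefC => ->.
  by rewrite mul1r.
have : (g * h).[y] = 0 by rewrite -fgs vf.
rewrite horner_mul_conj // => /mulD_eq0[|hy0]; last first.
  by rewrite hy0 eqxx in hy.
set y' := _ / _ => /rootP/factor_theorem[g' g'E].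
apply: (IHn g' (y' :: s)); last by rewrite big_cons mulrA -g'E.
  move: szg; rewrite g'E; case: (eqVneq g' 0) => [->|ng']; first by rewrite size_poly0.
  by rewrite size_Mmonic ?monicXsubC // size_XsubC addnC.
move=> c; rewrite inE => /orP[/eqP ->|/sC //].
exact: conjugate_of_conj.
Qed.

End DivisionAlgebra.

(** * The regular determinant *)

(** The polynomial matrix f I - f(A) is divisible by X I - A; with f(A) = 0,
    take determinants. *)
Lemma char_poly_dvd_exp (F : fieldType) n (A : 'M[F]_n.+1) (f : {poly F}) :
  horner_mx A f = 0 -> char_poly A %| f ^+ n.+1.
Proof.
have [phi [bphi phiZ phiC _]] := mx_poly_ring_isom F n.
move=> /rootP/factor_theorem[q fq]; have [psi psiK phiK] := bphi.
suff /(congr1 determinant) : f%:M = psi q *m char_poly_mx A.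
  by rewrite det_scalar det_mulmx => ->; apply: dvdp_mulIr.
apply: (can_inj psiK); rewrite rmorphM /= phiK phiZ fq; congr (_ * _).
by rewrite rmorphB phiC phiZ map_polyX.
Qed.

Lemma monic_dvd_irredp_exp (F : fieldType) (f p : {poly F}) n :
  f \is monic -> irreducible_poly f -> p \is monic -> p %| f ^+ n ->
  exists r, p = f ^+ r.
Proof.
move=> fmon [szf firr]; elim: n p => [|n IHn] p pmon.
  by rewrite expr0 dvdp1 size_poly_eq1 eqp_monic ?monic1 // => /eqP ->; exists 0%N.
have [cfp|] := boolP (coprimep p f).
  by rewrite exprS Gauss_dvdpr //; apply: IHn.
rewrite coprimep_def => szg.
have /firr/(_ (dvdp_gcdr p f)) := szg.
rewrite eqp_sym => fg; have fp : f %| p by rewrite (eqp_dvdl _ fg) dvdp_gcdl.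
move: pmon; rewrite -(divpK fp) monicMr // => pmon.
rewrite exprSr dvdp_mul2r ?monic_neq0 // => /(IHn _ pmon)[r ->].
by exists r.+1; rewrite exprSr.
Qed.

Section RegularRepresentation.
Variables (F : fieldType) (D : falgType F).
Implicit Types (x y : D).

(** Right multiplication is used because matrices act on row vectors from the
    right, so that regmx is a morphism rather than an antimorphism. *)
Definition regmx n (e : n.-tuple D) x : 'M[F]_n :=
  \matrix_(i, j) coord e j (e`_i * x).

Definition regdet x : F := \det (regmx (vbasis {:D}) x).

(** Minimal polynomials and the ring structure of square matrices require a
    dimension of the form n.+1. *)
Lemma succ_basis : exists n, exists2 e : n.+1.-tuple D,
  e = vbasis {:D} :> seq D & forall x, regdet x = \det (regmx e x).
Proof.
have dgt0 : (0 < \dim {:D})%N.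
  by rewrite lt0n dimv_eq0; apply/eqP => D0; have := memvf (1 : D);
     rewrite D0 memv0 oner_eq0.
rewrite /regdet; move: (vbasis {:D}).
by rewrite -(prednK dgt0) => e; exists (\dim {:D}).-1, e.
Qed.

Section Basis.
Variables (n : nat) (e : n.-tuple D).
Hypothesis be : basis_of {:D} e.

Lemma regmxE x (i : 'I_n) : e`_i * x = \sum_j regmx e x i j *: e`_j.
Proof.
rewrite [LHS](coord_basis be) ?memvf //.
by apply: eq_bigr => j _; rewrite mxE.
Qed.

Lemma regmxM x y : regmx e (x * y) = regmx e x *m regmx e y.
Proof.
apply/matrixP => i j; rewrite [LHS]mxE mulrA (regmxE x) mulr_suml linear_sum /=.
rewrite mxE; apply: eq_bigr => k _.
by rewrite -scalerAl linearZ /= [regmx e y _ _]mxE.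
Qed.

Lemma regmxD x y : regmx e (x + y) = regmx e x + regmx e y.
Proof. by apply/matrixP => i j; rewrite !mxE mulrDr linearD. Qed.

Lemma regmx0 : regmx e 0 = 0.
Proof. by apply/matrixP => i j; rewrite !mxE mulr0 linear0. Qed.

Lemma regmx_scalar (k : F) : regmx e k%:A = k%:M.
Proof.
apply/matrixP => i j; rewrite !mxE -scalerAr mulr1 linearZ /=.
by rewrite coord_free ?(basis_free be) // -[RHS]mulr_natr.
Qed.

Lemma regmx_eq0 x : regmx e x = 0 -> x = 0.
Proof.
move=> x0; rewrite -[x]mul1r [1](coord_basis be) ?memvf // mulr_suml.
rewrite big1 // => i _; rewrite -scalerAl regmxE big1 ?scaler0 // => j _.
by rewrite x0 mxE scale0r.
Qed.

End Basis.

Lemma horner_regmx n (e : n.+1.-tuple D) (be : basis_of {:D} e) x (p : {poly F}) :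
  horner_mx (regmx e x) p = regmx e (horner_alg x p).
Proof.
elim/poly_ind: p => [|p k IHp]; last first.
  rewrite !rmorphD !rmorphM /= horner_mx_X horner_mx_C horner_algX horner_algC.
  by rewrite regmxD regmxM // regmx_scalar // IHp.
by rewrite !rmorph0 regmx0.
Qed.

Hypothesis divD : forall x : D, x != 0 -> x \is a GRing.unit.
Hypothesis centerD : ('Z({:D}) = 1)%VS.

(** Up to sign, regdet x is a nonempty product of conjugates of x: the
    characteristic polynomial of right multiplication by x is a positive power
    of the minimal polynomial of x, which is irreducible as D has no zero
    divisors, and whose constant term is given by Wedderburn factorization. *)
Lemma regdet_closed (T : set D) x :
    (forall a b, T a -> T b -> T (a * b)) -> (forall a, T a -> T (- a)) ->
    (forall c, conjugate_of x c -> T c) ->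
  T (regdet x)%:A.
Proof.
move=> TM TN Tx; have [n [e ve ->]] := succ_basis.
have be : basis_of {:D} e by rewrite ve vbasisP.
set A := regmx e x; pose f := mxminpoly A.
have fmon : f \is monic by apply: mxminpoly_monic.
have szf : (1 < size f)%N by rewrite size_mxminpoly ltnS mxminpoly_nonconstant.
have rootA p : horner_mx A p = 0 <-> horner_alg x p = 0.
  rewrite horner_regmx //; split=> [/(regmx_eq0 be) //|->].
  exact: regmx0.
have fmin p : horner_alg x p = 0 -> f %| p by move/rootA/mxminpoly_min.
have fx0 : horner_alg x f = 0 by apply/rootA/mx_root_minpoly.
have firr : irreducible_poly f.
  split=> // q szq qf; have fE := divpK qf; set g := f %/ q in fE.
  have nf : f != 0 by rewrite monic_neq0.
  have /andP[ng nq] : (g != 0) && (q != 0) by rewrite -negb_or -mulf_eq0 fE.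
  have : horner_alg x g * horner_alg x q = 0 by rewrite -rmorphM /= fE.
  move/(mulD_eq0 divD) => [/fmin fg|/fmin fq]; last by rewrite /eqp qf fq.
  have := dvdp_leq ng fg; rewrite -fE size_mul //.
  move: szq; rewrite -size_poly_gt0 in nq; case: (size q) nq => // -[|k] //= _ _.
  by rewrite addnS /= -{2}[size g]addn0 leq_add2l.
have [|s sC fs] := Wedderburn_factorization divD centerD fmon fx0.
  by move=> q nq /fmin; apply: dvdp_leq.
have Tf0 : T (f`_0)%:A.
  have -> : (f`_0)%:A = (map_poly (in_alg D) f)`_0 by rewrite coef_map.
  rewrite fs; move: szf; rewrite -(size_map_poly (in_alg D) f) fs size_prod_XsubC ltnS.
  case: s sC {fs} => // c s sC _.
  elim: s c sC => [|b s IHs] c sC; rewrite big_cons.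
    by rewrite big_nil mulr1 coefB coefX coefC sub0r; apply/TN/Tx/sC/mem_head.
  rewrite coef0M coefB coefX coefC sub0r; apply: TM; first by apply/TN/Tx/sC/mem_head.
  by apply: IHs => a ai; apply: sC; rewrite inE ai orbT.
have [r cr] : exists r, char_poly A = f ^+ r.
  apply: (monic_dvd_irredp_exp (n := n.+1)) => //; first exact: char_poly_monic.
  exact/char_poly_dvd_exp/mx_root_minpoly.
have Tc : T ((char_poly A)`_0)%:A.
  have: (1 < size (char_poly A))%N by rewrite size_char_poly.
  rewrite cr; case: r {cr} => [|r _]; first by rewrite expr0 size_poly1.
  elim: r => [|r IHr]; first by rewrite expr1.
  by rewrite exprS coef0M -scalerA -mulr_algl; apply: TM.
move: Tc; rewrite char_poly_det; elim: {1}n.+1 => [|m IHm]; first by rewrite mul1r.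
by rewrite exprS mulN1r mulNr scaleNr => /TN; rewrite opprK.
Qed.

End RegularRepresentation.

(** * Comparison with the reduced norm *)

Lemma det_mxdiag (R : comNzRingType) m (p_ : 'I_m -> nat)
    (B_ : forall i, 'M[R]_(p_ i)) :
  \det (\mxdiag_i B_ i) = \prod_i \det (B_ i).
Proof.
elim: m p_ B_ => [|m IHm] p_ B_.
  rewrite [RHS]big_ord0; move: (\mxdiag_i B_ i); rewrite big_ord0 => A.
  exact: det_mx00.
have det_cast k l (ekl : k = l) (A : 'M[R]_k) : \det (castmx (ekl, ekl) A) = \det A.
  by case: _ / ekl.
by rewrite mxdiag_recl det_cast det_lblock IHm [RHS]big_ord_recl.
Qed.

Lemma det_intertwined (K : fieldType) m n (P : 'M[K]_(m, n)) A B :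
  m = n -> row_free P -> A *m P = P *m B -> \det A = \det B.
Proof.
move=> mn; case: _ / mn in P B *.
rewrite row_free_unit unitmxE => uP /(congr1 determinant).
by rewrite !det_mulmx mulrC => /(mulrI uP).
Qed.

(** Right multiplication by Y on n by n matrices acts on each of the n rows as
    Y, so its determinant is the n-th power of that of Y; a splitting
    identifies it with right multiplication by x after extension of scalars. *)
Lemma splitting_regdet (F : fieldType) (D : falgType F) (L : fieldType)
    (iota : {rmorphism F -> L}) n (phi : {rmorphism D -> 'M[L]_n}) (x : D) :
  splitting iota phi -> iota (regdet x) = \det (phi x) ^+ n.
Proof.
move=> [phiZ bphi]; set e := vbasis {:D}.
have -> : \det (phi x) ^+ n = \det (\mxdiag_(i < n) phi x).
  by rewrite det_mxdiag prodr_const card_ord.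
rewrite /regdet -det_map_mx.
pose b := [tuple of map phi e].
have bb : basis_of {:'M[L]_n} b by [].
have bE (i : 'I_(\dim {:D})) : b`_i = phi e`_i by rewrite (nth_map 0) ?size_tuple.
pose vec (Z : 'M[L]_n) : 'rV_(\sum_(k < n) n) := \mxrow_(k < n) row k Z.
have vec_sum (c : 'I_(\dim {:D}) -> L) (Z : 'I_(\dim {:D}) -> 'M[L]_n) :
    vec (\sum_i c i *: Z i) = \sum_i c i *: vec (Z i).
  apply/rowP => j; rewrite summxE !mxE summxE.
  by apply: eq_bigr => i _; rewrite !mxE.
have vec_eq0 (Z : 'M[L]_n) : vec Z = 0 -> Z = 0.
  move=> Z0; apply/row_matrixP => k; rewrite row0.
  have vZ0 : vec Z = \mxrow_(k < n) 0 by rewrite mxrow0.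
  exact: ((eq_mxrowP (fun k => row k Z) (fun=> 0)).2 vZ0 k).
have vecM (Z Y : 'M[L]_n) : vec (Z * Y) = vec Z *m \mxdiag_(k < n) Y.
  by rewrite mul_mxrow_mxdiag; apply/eq_mxrow => k; rewrite row_mul.
(* P is the change of basis from the image of e to the matrix units. *)
pose P := \matrix_(i < \dim {:D}) vec (phi e`_i).
apply: (det_intertwined (P := P)).
- rewrite sum_nat_const card_ord -(size_basis bb) dimvf; exact: dim_matrix.
- apply: inj_row_free => v vP0.
  have vb0 : \sum_i v 0 i *: b`_i = 0.
    apply: vec_eq0; rewrite vec_sum -[RHS]vP0 mulmx_sum_row.
    by apply: eq_bigr => i _; rewrite rowK bE.
  apply/rowP => i; rewrite mxE.
  by move/freeP: (basis_free bb) => /(_ (fun i => v 0 i)); apply.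
- apply/row_matrixP => i; rewrite !row_mul rowK -vecM -rmorphM.
  rewrite (regmxE (vbasisP _)) rmorph_sum mulmx_sum_row.
  transitivity (\sum_j iota (regmx e x i j) *: vec (phi e`_j)).
    by apply: eq_bigr => j _; rewrite rowK [row _ _ _ _]mxE [map_mx _ _ _ _]mxE.
  by rewrite -vec_sum; congr vec; apply: eq_bigr => j _; rewrite phiZ.
Qed.

Section RegdetKernel.
Variables (F : fieldType) (D : falgType F).
Hypothesis divD : forall x : D, x != 0 -> x \is a GRing.unit.
Implicit Types x y : D.

Lemma regdetM x y : regdet (x * y) = regdet x * regdet y.
Proof. by rewrite /regdet regmxM ?vbasisP // det_mulmx. Qed.

Lemma regdet1 : regdet (1 : D) = 1.
Proof.
rewrite /regdet -(scale1r 1) regmx_scalar ?vbasisP //; exact: det1.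
Qed.

Definition regdet_ker : set D := [set x | x != 0 /\ regdet x = 1].

Lemma regdet_ker_normal : normal_subgroup regdet_ker.
Proof.
have detV x : x != 0 -> regdet x^-1 * regdet x = 1.
  by move=> /divD ux; rewrite -regdetM mulVr // regdet1.
split.
- by move=> x [].
- by split; [exact: oner_neq0 | exact: regdet1].
- move=> x y [nx x1] [ny y1]; split; first exact: mulD_neq0.
  by rewrite regdetM x1 y1 mulr1.
- move=> x [nx x1]; split; first exact: invD_neq0.
  by have := detV x nx; rewrite x1 mulr1.
- move=> g x ng [nx x1]; split; first by rewrite !mulD_neq0 ?invD_neq0.
  by rewrite !regdetM x1 mulr1 detV.
Qed.

(** The value 1 differs from the default value 0 of reduced_norm, so it comes
    from an actual splitting. *)
Lemma reduced_norm1_ker x : reduced_norm1 x -> regdet_ker x.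
Proof.
move=> [nx]; rewrite /reduced_norm; case: xgetP => [_ -> | _ /esym/eqP]; last first.
  by rewrite oner_eq0.
move=> [L [iota [n [phi [sphi /esym detx]]]]] c1; split=> //.
move: detx; rewrite c1 rmorph1 => detx.
by apply: (fmorph_inj iota); rewrite (splitting_regdet x sphi) detx expr1n rmorph1.
Qed.

End RegdetKernel.

(** * Additive spans *)

Section AdditiveSpan.
Variable D : nzRingType.
Implicit Types P Q T : set D.

Inductive addspan P : set D :=
| addspan0 : addspan P 0
| addspan_cons x y : P x -> addspan P y -> addspan P (x + y).

Lemma sub_addspan P x : P x -> addspan P x.
Proof. by move=> Px; rewrite -[x]addr0; apply: addspan_cons (addspan0 P). Qed.

Lemma addspanD P x y : addspan P x -> addspan P y -> addspan P (x + y).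
Proof.
elim=> [|a b Pa _ IH]; first by rewrite add0r.
by move=> /IH ?; rewrite -addrA; apply: addspan_cons.
Qed.

Lemma addspanM P Q T : (forall x y, P x -> Q y -> T (x * y)) ->
  forall x y, addspan P x -> addspan Q y -> addspan T (x * y).
Proof.
move=> PQT x y; elim=> [|a b Pa _ IHx] Qy.
  by rewrite mul0r; apply: addspan0.
rewrite mulrDl; apply: addspanD (IHx Qy).
elim: Qy => [|c d Qc _ IHy]; first by rewrite mulr0; apply: addspan0.
by rewrite mulrDr; apply: addspan_cons => //; apply: PQT.
Qed.

Lemma addspan_sum P I (r : seq I) (f : I -> D) :
  (forall i, addspan P (f i)) -> addspan P (\sum_(i <- r) f i).
Proof.
move=> Pf; elim: r => [|i r IH]; first by rewrite big_nil; apply: addspan0.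
by rewrite big_cons; apply: addspanD.
Qed.

End AdditiveSpan.

(** * The valuation-like structure on N *)

Section UHypothesis.
Variables (F : fieldType) (D : falgType F).
Hypothesis divD : forall x : D, x != 0 -> x \is a GRing.unit.
Variables (N S : set D).
Hypothesis (hN : normal_subgroup N) (hU : U_hypothesis N S).
Implicit Types (x y g n m : D).

Definition unitS : set D := [set n | [/\ N n, S n & S n^-1]].
Definition small : set D := N `\` S.
Definition integral : set D := [set n | N n /\ S n^-1].

Let N0 n : N n -> n != 0. Proof. by case: hN => H _ _ _ _; apply: H. Qed.
Let N1 : N 1. Proof. by case: hN. Qed.
Let NM x y : N x -> N y -> N (x * y). Proof. by case: hN => _ _ H _ _; apply: H. Qed.
Let NV x : N x -> N x^-1. Proof. by case: hN => _ _ _ H _; apply: H. Qed.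
Let NJ g x : g != 0 -> N x -> N (g^-1 * x * g).
Proof. by case: hN => _ _ _ _ H; apply: H. Qed.
Let uN n : N n -> n \is a GRing.unit. Proof. by move=> /N0/divD. Qed.

Let SN x : S x -> N x.
Proof. by case: hU => [[_ [H _] _] _]; apply: H. Qed.
Let SJ g x : g != 0 -> S x -> S (g^-1 * x * g).
Proof. by case: hU => [[_ _ H] _]; apply: H. Qed.
Let S1 : S 1. Proof. by case: hU => _ [[]]. Qed.
Let SN1 : S (-1). Proof. by case: hU => _ [[]]. Qed.
Let SM x y : S x -> S y -> S (x * y).
Proof. by move=> Sx Sy; case: hU => _ [_ <- _]; exists x => //; exists y. Qed.
Let SD1 n : small n -> S (n + 1).
Proof. by move=> sn; case: hU => _ [_ _ H]; case: (H n sn). Qed.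

Lemma small_not_S n : small n -> ~ S n. Proof. by case. Qed.

Lemma integral_small x y : integral x -> small y -> small (x * y).
Proof.
move=> [Nx SVx] [Ny nSy]; split; first exact: NM.
by move=> Sxy; apply: nSy; rewrite -[y](mulKr (uN Nx)); apply: SM.
Qed.

Lemma small_integral x y : small x -> integral y -> small (x * y).
Proof.
move=> [Nx nSx] [Ny SVy]; split; first exact: NM.
by move=> Sxy; apply: nSx; rewrite -[x](mulrK (uN Ny)); apply: SM.
Qed.

Lemma small_conj g x : g != 0 -> small x -> small (g^-1 * x * g).
Proof.
move=> ng [Nx nSx]; split; first exact: NJ.
move=> /(SJ (invD_neq0 divD ng)); rewrite invrK !mulrA divrr ?divD // mul1r.
by rewrite -mulrA divrr ?divD // mulr1.
Qed.

Lemma integralN1 : integral (-1).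
Proof. by split; rewrite ?invrN ?invr1 //; apply: SN. Qed.

Lemma smallN n : small n -> small (- n).
Proof. by rewrite -mulN1r; apply: integral_small; apply: integralN1. Qed.

Lemma integralM x y : integral x -> integral y -> integral (x * y).
Proof.
move=> [Nx SVx] [Ny SVy]; split; first exact: NM.
by rewrite invrM ?uN //; apply: SM.
Qed.

Lemma integral_conj g x : g != 0 -> integral x -> integral (g^-1 * x * g).
Proof.
move=> ng [Nx SVx]; split; first exact: NJ.
have [ug ux] := (divD ng, uN Nx).
have ugx : g^-1 * x \is a GRing.unit.
  by apply/divD/(mulD_neq0 divD); [exact: invD_neq0 | exact: N0].
by rewrite invrM // invrM ?unitrV // invrK mulrA; apply: SJ.
Qed.

Lemma unit_integral x : unitS x -> integral x. Proof. by case. Qed.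

Lemma unitV x : unitS x -> unitS x^-1.
Proof. by move=> [Nx Sx SVx]; split; rewrite ?invrK //; apply: NV. Qed.

(** Put s = n + 1, which is in S.  If s^-1 were small, then 1 - s^-1 = s^-1 n
    would be in S, and multiplying by s would put n in S. *)
Lemma unit_add1_small n : small n -> unitS (1 + n).
Proof.
move=> sn; have Ss := SD1 sn; rewrite addrC; set s := n + 1 in Ss *.
split=> //; first exact: SN.
apply: contrapT => nSV.
have us := uN (SN Ss).
have /smallN/SD1 : small s^-1 by split=> //; apply/NV/SN.
have -> : - s^-1 + 1 = s^-1 * n.
  by rewrite -[n in RHS](addrK 1) mulrBr mulVr // mulr1 addrC.
by move=> /(SM Ss); rewrite mulVKr //; case: sn.
Qed.

(** If n and n^-1 were both small, both 1 + n and 1 + n^-1 would be in U, and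
    so would their quotient n^-1. *)
Lemma small_inv n : small n -> S n^-1.
Proof.
move=> sn; apply: contrapT => nSV; have un := uN sn.1.
have [_ Ss SVs] := unit_add1_small sn.
have [_ Ss' _] : unitS (1 + n^-1).
  by apply: unit_add1_small; split=> //; apply/NV; case: sn.
apply: nSV; have -> : n^-1 = (1 + n^-1) * (1 + n)^-1.
  have us := uN (SN Ss); apply: (mulIr us); rewrite mulrVK //.
  by rewrite mulrDr mulr1 mulVr // addrC.
exact: SM.
Qed.

Lemma small_sub_integral n : small n -> integral n.
Proof. by move=> sn; split; [case: sn | apply: small_inv]. Qed.

Lemma smallM x y : small x -> small y -> small (x * y).
Proof. by move=> /small_sub_integral; apply: integral_small. Qed.

(** The generalization to n + y with n in U makes the induction work: for a
    small, n + a = n (1 + n^-1 a) is again in U. *)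
Lemma unit_add1_addspan x : addspan small x -> unitS (1 + x).
Proof.
suff ind y : addspan small y -> forall n, unitS n -> unitS (n + y).
  by move=> /ind; apply; split; rewrite ?invr1.
elim=> [|a b sa _ IH] n un; first by rewrite addr0.
rewrite addrA; apply: IH.
have [Nn Sn SVn] := un; have unn := uN Nn.
have -> : n + a = n * (1 + n^-1 * a) by rewrite mulrDr mulr1 mulVKr.
have [Nw Sw SVw] : unitS (1 + n^-1 * a).
  exact/unit_add1_small/integral_small/sa/unit_integral/unitV.
by split; [apply: NM | apply: SM | rewrite invrM ?uN //; apply: SM].
Qed.

(** * Nakayama and the normal subgroup 1 + J *)

Variables (gT : finGroupType) (pi : D -> gT).
Hypotheses (hpi : quotient_map pi N) (simpleG : simple [set: gT]%G).
Variable H : set D.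
Hypotheses (hH : normal_subgroup H) (HN : forall x, H x -> N x -> S x).
Implicit Types h : D.

Local Notation U := unitS.
Local Notation W := (addspan small).
Local Notation A := (addspan integral).

Let H0 h : H h -> h != 0. Proof. by case: hH => h0 _ _ _ _; apply: h0. Qed.
Let H1 : H 1. Proof. by case: hH. Qed.
Let HM x y : H x -> H y -> H (x * y).
Proof. by case: hH => _ _ h _ _; apply: h. Qed.
Let HV x : H x -> H x^-1. Proof. by case: hH => _ _ _ h _; apply: h. Qed.
Let HJ g x : g != 0 -> H x -> H (g^-1 * x * g).
Proof. by case: hH => _ _ _ _ h; apply: h. Qed.
Let uH h : H h -> h \is a GRing.unit. Proof. by move=> /H0/divD. Qed.
Let piM x y : x != 0 -> y != 0 -> pi (x * y) = (pi x * pi y)%g.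
Proof. by case: hpi => h _ _; apply: h. Qed.
Let piN x : x != 0 -> pi x = 1%g <-> N x.
Proof. by case: hpi => _ _ h; apply: h. Qed.

Lemma HN_unitS x : H x -> N x -> U x.
Proof. by move=> Hx Nx; split=> //; apply: HN => //; [apply: HV | apply: NV]. Qed.

Lemma WM_Al a w : A a -> W w -> W (a * w).
Proof. exact/addspanM/integral_small. Qed.

Lemma WM_Ar w a : W w -> A a -> W (w * a).
Proof. exact/addspanM/small_integral. Qed.

(** The lemma of Nakayama for the finite family r, over the ring A and the
    ideal W, modulo the A-submodule T.  Since 1 - w i is in U, the relation
    for r i expresses r i through the remaining members of the family, and r i
    can be eliminated. *)
Lemma nakayama (T : set D) (I : eqType) (s : seq I) (r : I -> D) :
    T 0 -> (forall x y, T x -> T y -> T (x + y)) ->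
    (forall n x, integral n -> T x -> T (n * x)) ->
    (forall i, i \in s ->
      exists2 w : I -> D, (forall j, W (w j)) &
        T (r i - \sum_(j <- s) w j * r j)) ->
  forall i, i \in s -> T (r i).
Proof.
move=> T0 TD Tint; have TA a x : A a -> T x -> T (a * x).
  move=> Aa Tx; elim: Aa => [|b c Ib _ IH]; first by rewrite mul0r.
  by rewrite mulrDl; apply: TD => //; apply: Tint.
have TW w x : W w -> T x -> T (w * x).
  move=> Ww; apply: TA; elim: Ww => [|b c sb _ IH]; first exact: addspan0.
  by apply: addspan_cons IH; apply: small_sub_integral.
have Tsum (t : seq I) (w : I -> D) : (forall j, W (w j)) ->
    (forall j, j \in t -> T (r j)) -> T (\sum_(j <- t) w j * r j).
  move=> Ww Tt; rewrite big_seq; elim/big_ind: _ => // j jt.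
  by apply: TW => //; apply: Tt.
elim: s => // i s IHs rel.
have [w Ww] := rel i (mem_head _ _); rewrite big_cons => Ti.
have Uu : U (1 - w i).
  apply: unit_add1_addspan.
  by rewrite -mulN1r; apply: WM_Al => //; apply/sub_addspan/integralN1.
set u := 1 - w i in Uu; have uu : u \is a GRing.unit by apply: uN; case: Uu.
have Iu : integral u^-1 by apply/unit_integral/unitV.
pose w' j := u^-1 * w j.
have Ww' j : W (w' j) by apply: WM_Al => //; apply: sub_addspan.
have Ti' : T (r i - \sum_(j <- s) w' j * r j).
  have := Tint _ _ Iu Ti; congr T.
  rewrite opprD addrA -{1}[r i]mul1r -mulrBl -/u mulrBr mulKr // mulr_sumr.
  by congr (_ - _); apply: eq_bigr => j _; rewrite mulrA.
have Ts : forall k, k \in s -> T (r k).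
  apply: IHs => k ks; have [v Wv Tk] := rel k (mem_behead (s := i :: s) ks).
  exists (fun j => v j + v i * w' j).
    move=> j; apply: addspanD => //; apply: WM_Ar => //.
    elim: (Ww' j) => [|b c sb _ IH]; first exact: addspan0.
    by apply: addspan_cons IH; apply: small_sub_integral.
  have := TD _ _ Tk (TW _ _ (Wv i) Ti'); congr T.
  rewrite big_cons mulrBr -[X in _ + X]opprB -addrA -opprD; congr (_ - _).
  rewrite [X in X + _]addrC -addrA [X in _ + X]addrC subrK.
  rewrite mulr_sumr -big_split; apply: eq_bigr => j _ /=.
  by rewrite mulrDl mulrA.
move=> k; rewrite inE => /orP[/eqP ->|]; last exact: Ts.
by rewrite -[r i](subrK (\sum_(j <- s) w' j * r j)); apply: TD => //; apply: Tsum.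
Qed.

Definition smallH : set D := [set x * h | x in small & h in H].

Local Notation J := (addspan smallH).

(** The default value 1 is in H, so repH t is in H for every t, whether or not
    H meets the fibre of pi over t. *)
Definition repH (t : gT) : D := xget 1 [set h | H h /\ pi h = t].

Lemma repH_H t : H (repH t).
Proof. by rewrite /repH; case: xgetP => // h _ []. Qed.

(** Elements of H with the same image under pi differ by an element of H that
    is in N, hence in U. *)
Lemma H_repH h : H h -> exists2 u, U u & h = u * repH (pi h).
Proof.
move=> Hh; have [Hr pir] : H (repH (pi h)) /\ pi (repH (pi h)) = pi h.
  by apply: (xgetPex 1 (P := [set k | H k /\ pi k = pi h])); exists h.
set r := repH _ in Hr pir *; exists (h / r); last by rewrite mulrVK ?uH.
apply: HN_unitS; first by apply: HM => //; apply: HV.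
have Hhr : H (h / r) by apply: HM => //; apply: HV.
apply/piN; first exact: H0.
apply: (mulIg (pi r)); rewrite mul1g -piM ?H0 // mulrVK ?uH //.
Qed.

Lemma J_repH x : J x -> exists2 w : gT -> D, (forall t, W (w t)) &
  x = \sum_t w t * repH t.
Proof.
elim=> [|_ y [n sn [h Hh <-]] _ [w Ww ->]].
  exists (fun=> 0); first by move=> t; apply: addspan0.
  by rewrite big1 // => t _; rewrite mul0r.
have [u Uu hE] := H_repH Hh.
exists (fun t => (if t == pi h then n * u else 0) + w t).
  move=> t; apply: addspanD => //; case: eqP => _; last exact: addspan0.
  exact/sub_addspan/small_integral/unit_integral.
under [RHS]eq_bigr do rewrite mulrDl.
rewrite big_split /=; congr (_ + _); rewrite (bigD1 (pi h)) //= eqxx big1.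
  by rewrite addr0 -mulrA -hE.
by move=> t /negPf ->; rewrite mul0r.
Qed.

Lemma J_HM x h : J x -> H h -> J (x * h).
Proof.
move=> Jx Hh; apply: (addspanM (P := smallH) (Q := H)) => //; last exact: sub_addspan.
move=> _ k [n sn [h' Hh' <-]] Hk; exists n => //; exists (h' * k); first exact: HM.
by rewrite mulrA.
Qed.

Lemma J_HMl h x : H h -> J x -> J (h * x).
Proof.
move=> Hh Jx; apply: (addspanM (P := H) (Q := smallH)) => //; last exact: sub_addspan.
move=> k _ Hk [n sn [h' Hh' <-]].
exists (k * n / k); last by exists (k * h'); [exact: HM | rewrite !mulrA mulrVK ?uH].
by rewrite -{1}[k]invrK; apply: small_conj => //; apply/(invD_neq0 divD)/H0.
Qed.

Lemma J_integralM x n : J x -> integral n -> J (x * n).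
Proof.
move=> Jx In; apply: (addspanM (P := smallH) (Q := integral)) => //; last exact: sub_addspan.
move=> _ k [m sm [h Hh <-]] Ik; exists (m * (h * k / h)).
  apply: small_integral => //.
  by rewrite -{1}[h]invrK; apply: integral_conj => //; apply/(invD_neq0 divD)/H0.
by exists h => //; rewrite !mulrA mulrVK ?uH.
Qed.

Lemma JN x : J x -> J (- x).
Proof.
by rewrite -mulrN1 => Jx; apply: J_integralM => //; apply: integralN1.
Qed.

Lemma JM x y : J x -> J y -> J (x * y).
Proof.
move=> Jx; elim=> [|_ b [n sn [h Hh <-]] _ IH].
  by rewrite mulr0; apply: addspan0.
rewrite mulrDr; apply: addspanD IH; rewrite mulrA.
by apply: J_HM => //; apply/J_integralM/small_sub_integral.
Qed.

Lemma J_conj g x : g != 0 -> J x -> J (g^-1 * x * g).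
Proof.
move=> ng; elim=> [|_ b [n sn [h Hh <-]] _ IH].
  by rewrite mulr0 mul0r; apply: addspan0.
rewrite mulrDr mulrDl; apply: addspan_cons IH.
exists (g^-1 * n * g); first exact: small_conj.
exists (g^-1 * h * g); first exact: HJ.
by rewrite -!mulrA (mulrA g) divrr ?divD // mul1r.
Qed.

(** If 1 is in J, so is all of H, and each representative is a combination of
    the representatives with coefficients in W; Nakayama with T = 0 makes them
    vanish. *)
Lemma one_notin_J : ~ J 1.
Proof.
move=> J1; have : [set 0 : D] (repH 1%g).
  apply: (nakayama (s := index_enum gT)) => //.
  - by move=> _ _ -> ->; rewrite /= addr0.
  - by move=> n _ _ ->; rewrite /= mulr0.
  - move=> t _; have /J_repH[w Ww rE] : J (repH t).
      by rewrite -[repH t]mul1r; apply: J_HM => //; apply: repH_H.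
    by exists w => //=; rewrite {1}rE subrr.
by move=> r0; have := H0 (repH_H 1%g); rewrite r0 eqxx.
Qed.

Lemma one_plus_J_neq0 x : J x -> 1 + x != 0.
Proof.
move=> Jx; apply/eqP => x0; apply: one_notin_J.
have -> : 1 = - x by apply/eqP; rewrite -addr_eq0 x0.
exact: JN.
Qed.

Definition imJ : {set gT} := [set t | `[< exists2 x, J x & pi (1 + x) = t >]]%SET.

Lemma imJP t : reflect (exists2 x, J x & pi (1 + x) = t) (t \in imJ).
Proof. by rewrite inE; apply: asboolP. Qed.

Lemma imJ_group_set : group_set imJ.
Proof.
apply/group_setP; split.
  apply/imJP; exists 0; first exact: addspan0.
  by rewrite addr0; apply/piN => //; apply: oner_neq0.
move=> _ _ /imJP[x Jx <-] /imJP[y Jy <-]; apply/imJP.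
exists (x + (y + x * y)); first by do 2![apply: addspanD => //]; apply: JM.
rewrite -piM ?one_plus_J_neq0 //; congr pi.
by rewrite mulrDr mulr1 mulrDl mul1r !addrA addrAC.
Qed.

Lemma imJ_normal : (group imJ_group_set <| [set: gT]%SET)%g.
Proof.
rewrite /normal finset.subsetT; apply/fintype.subsetP => t _; rewrite inE.
apply/fintype.subsetP => _ /imsetP[_ /imJP[x Jx <-] ->]; apply/imJP.
have [_ /(_ t)[g ng <-] _] := hpi.
exists (g^-1 * x * g); first exact: J_conj.
have nx := one_plus_J_neq0 Jx.
apply: (mulgI (pi g)); rewrite -piM ?one_plus_J_neq0 //; last exact: J_conj.
rewrite conjgE mulKVg -piM //; congr pi.
by rewrite mulrDr mulr1 !mulrA divrr ?divD // mul1r mulrDl mul1r.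
Qed.

(** When 1 + J covers gT, every h in H is (1 + x) n with x in J and n in N.
    Here n is integral: otherwise n^-1 is small and 1 = h n^-1 - x would be
    in J.  So h is congruent modulo J to the element n of A, and Nakayama with
    T = A puts H inside A. *)
Lemma J_sub_W_of_full : imJ = [set: gT]%SET -> forall x, J x -> W x.
Proof.
move=> full; have A_approx h : H h -> exists2 a, A a & J (h - a).
  move=> Hh; have : pi h \in imJ by rewrite full inE.
  case/imJP => x Jx pixh; have n1x := one_plus_J_neq0 Jx.
  have u1x := divD n1x; pose n := (1 + x)^-1 * h.
  have nn : n != 0 by apply: (mulD_neq0 divD) (invD_neq0 divD n1x) (H0 Hh).
  have hE : h = (1 + x) * n by rewrite mulVKr.
  have Nn : N n.
    by apply/piN => //; apply: (mulgI (pi (1 + x))); rewrite -piM // -hE mulg1.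
  have SVn : S n^-1.
    apply: contrapT => nSn; have sn : small n^-1 by split=> //; apply: NV.
    have un := divD nn; apply: one_notin_J.
    have -> : 1 = h / n - x by rewrite hE mulrK // addrK.
    apply/addspanD/JN => //; apply/J_HMl/sub_addspan => //.
    by exists n^-1 => //; exists 1; rewrite ?mulr1.
  exists n; first by apply: sub_addspan.
  by rewrite hE mulrDl mul1r addrAC subrr add0r; apply: J_integralM.
have rA t : A (repH t).
  apply: (nakayama (s := index_enum gT)) => //.
  - exact: addspan0.
  - exact: addspanD.
  - move=> n x In; exact/(addspanM integralM)/sub_addspan.
  - move=> i _; have [a Aa /J_repH[w Ww rE]] := A_approx _ (repH_H i).
    by exists w => //; rewrite -rE subKr.
move=> x /J_repH[w Ww ->]; apply: addspan_sum => t.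
exact: WM_Ar.
Qed.

(** Simplicity of gT leaves the two cases of a trivial and of a full image. *)
Lemma one_plus_J_sub_N x : J x -> N (1 + x).
Proof.
have /simpleP[_ /(_ (group imJ_group_set) imJ_normal)[] imJE] := simpleG => Jx.
  have : pi (1 + x) \in group imJ_group_set by apply/imJP; exists x.
  by rewrite imJE inE => /eqP/piN; apply; apply: one_plus_J_neq0.
by case: (unit_add1_addspan (J_sub_W_of_full imJE Jx)).
Qed.

End UHypothesis.

Theorem mainTheorem2 (F : fieldType) (D : falgType F) (N : set D)
    (gT : finGroupType) (pi : D -> gT) (X : {set gT})
    (hD : central_division_algebra D)
    (hN : normal_subgroup N)
    (hF : forall c : F, c != 0 -> N (c%:A))
    (hpi : quotient_map pi N)
    (hsimple : simple [set: gT]%G)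
    (hnonab : ~~ abelian [set: gT]%G)
    (hX : (exists A : {set gT}, case_I N pi A X) \/ case_II N pi X) :
  Khat N pi X = OU N pi X `\` N.
Proof.
have [centerD divD] := hD.
set S := NN N pi X.
have hU : U_hypothesis N S by case: hX => [[B []]|[]].
have [_ [[S1 _] _ _]] := hU.
have SN m : S m -> N m by case: hU => [[_ [SN _] _] _]; apply: SN.
have [_ _ _ NV _] := hN.
have hH := regdet_ker_normal divD.
(* A small x would make the regular determinant, which is 1, small. *)
have HN x : regdet_ker x -> N x -> S x.
  move=> [_ x1] Nx; apply: contrapT => nSx; have sx : small N S x by [].
  apply: (@small_not_S _ _ N S (regdet x)%:A); last by rewrite x1 scale1r.
  apply: (regdet_closed divD centerD).
  - exact: (smallM divD hN hU).
  - exact: (smallN divD hN hU).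
  - by move=> _ [g ng ->]; apply: (small_conj divD hN hU).
apply/seteqP; split=> a; first by case.
move=> aOU; split=> // m [Sm nUm]; have Nm := SN _ Sm.
have [[x /reduced_norm1_ker Hx [u [Nu Su SVu] <-]] _] := aOU.
have um : m \is a GRing.unit by apply: divD; case: hN => N0 _ _ _ _; apply: N0.
have ux : x \is a GRing.unit by apply: divD; case: Hx.
split=> //; have -> : x * u + m = m * (1 + m^-1 * (x * u)).
  by rewrite mulrDr mulr1 mulVKr // addrC.
have [_ _ NM _ _] := hN; apply: NM => //.
apply: (one_plus_J_sub_N divD hN hU hpi hsimple hH HN); apply: sub_addspan.
(* Moving u to the left of x brings m^-1 x u into the form small times H. *)
exists (m^-1 * (x * u * x^-1)); last by exists x => //; rewrite !mulrA mulrVK.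
apply: (small_integral divD hN hU).
  by split; [exact: NV | move=> SVm; apply: nUm].
rewrite -{1}[x]invrK; apply: (integral_conj divD hN hU) => //.
by apply: (invD_neq0 divD); case: Hx.
Qed.
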